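(* The following equivalences hold: $$\mathsf{B}\equiv_{\mathrm{sW}}^{*}\mathsf{K}_\geq\equiv_{\mathrm{W}}^{*}\mathsf{G}\equiv_{\mathrm{sW}}^{*}\mathsf{K}\equiv_{\mathrm{sW}}^{*}\mathsf{C}_{\mathbb N},$$ and $\mathsf{G}_\geq$ is continuous.
   Context: Weihrauch complexity. $f:\subseteq X\rightrightarrows Y$ denotes a partial multivalued map. A represented space $(X,\delta_X)$ is a set $X$ with a surjective partial map $\delta_X:\subseteq\mathbb N^{\mathbb N}\to X$. A partial function $F:\subseteq\mathbb N^{\mathbb N}\to\mathbb N^{\mathbb N}$ is a realizer of $f:\subseteq X\rightrightarrows Y$, written $F\vdash f$, if $\delta_YF(p)\in f(\delta_X(p))$ for all $p\in\mathrm{dom}(f\delta_X)$. A problem is a multivalued map on represented spaces that has a realizer. $\mathbb N^{\mathbb N}$, $\mathbb N$ and products carry the standard representations; $\langle\cdot\rangle$ denotes standard pairing/tupling. $f\leq_{\mathrm W}^{*}g$ holds if there are continuous $H,L:\subseteq\mathbb N^{\mathbb N}\to\mathbb N^{\mathbb N}$ such that $H\langle\mathrm{id},\Gamma L\rangle\vdash f$ whenever $\Gamma\vdash g$; $f\leq_{\mathrm{sW}}^{*}g$ holds if there are continuous $H,L$ such that $H\Gamma L\vdash f$ whenever $\Gamma\vdash g$. $\equiv_{\mathrm W}^{*}$ and $\equiv_{\mathrm{sW}}^{*}$ are the corresponding equivalences. A problem is continuous if it has a continuous realizer. Gödel problem and variants. $\varphi$ is a fixed standard (acceptable) Gödel numbering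 of the partial computable functions $\subseteq\mathbb N\to\mathbb N$. - $\mathsf{G}:\subseteq\mathbb N^{\mathbb N}\rightrightarrows\mathbb N$, $\mathsf{G}(p)=\{i\in\mathbb N:\varphi_i=p\}$, with domain the set of all (total) computable sequences $p\in\mathbb N^{\mathbb N}$. - $\mathsf{K}:\subseteq\mathbb N^{\mathbb N}\to\mathbb N$, $\mathsf{K}(p)=\min\mathsf{G}(p)$, $\mathrm{dom}(\mathsf K)=\mathrm{dom}(\mathsf G)$ (Kolmogorov complexity). - $\mathsf{G}_\geq:\subseteq\mathbb N^{\mathbb N}\times\mathbb N\rightrightarrows\mathbb N$, $\mathsf{G}_\geq(p,m)=\mathsf{G}(p)$, with domain $\{(p,m):p\in\mathrm{dom}(\mathsf G),\ m\geq\mathsf{K}(p)\}$. - $\mathsf{K}_\geq:\subseteq\mathbb N^{\mathbb N}\rightrightarrows\mathbb N$, $\mathsf{K}_\geq(p)=\{m\in\mathbb N:m\geq\mathsf{K}(p)\}$, $\mathrm{dom}(\mathsf K_\geq)=\mathrm{dom}(\mathsf G)$. Other problems. - $\mathsf{B}:\subseteq\mathbb N^{\mathbb N}\rightrightarrows\mathbb N$, $\mathsf{B}(p)=\{m\in\mathbb N:(\forall n)\ p(n)\leq m\}$, defined on all bounded sequences. - $\mathsf{C}_{\mathbb N}:\subseteq\mathbb N^{\mathbb N}\rightrightarrows\mathbb N$, $\mathsf{C}_{\mathbb N}(p)=\{n\in\mathbb N:(\forall k)\ p(k)\neq n\}$, with domain $\{p:\mathrm{range}(p)\subsetneqq\mathbb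 N\}$ (closed choice). *)

(* Defs.v *)
From HB Require Import structures.
From mathcomp Require Import all_boot all_order.
From mathcomp Require Import boolp classical_sets topology.

Set Implicit Arguments.
Unset Strict Implicit.
Unset Printing Implicit Defensive.

Local Open Scope classical_set_scope.
Local Open Scope nat_scope.

(* A partial function X -> Y is encoded as a total function X -> option Y,
   undefined exactly where its value is None. *)
Definition pfun (X Y : Type) := X -> option Y.

Definition pdom (X Y : Type) (f : pfun X Y) : set X :=
  [set x | exists y, f x = Some y].

Definition pcomp (X Y Z : Type) (g : pfun Y Z) (f : pfun X Y) : pfun X Z :=
  fun x => obind g (f x).

(* The partial recursive functions in the sense of Kleene. Since the values of
   an option-valued function are determined by its graph, composition and
   minimisation are described through the graph of the resulting function. *)
Fixpoint prim_rec (n : nat) (f : pfun (n.-tuple nat) nat)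
    (g : pfun (n.+2.-tuple nat) nat) (v : n.-tuple nat) (k : nat) : option nat :=
  if k is k'.+1 then
    obind (fun r => g [tuple of k' :: r :: v]) (prim_rec f g v k')
  else f v.

Inductive partial_recursive : forall n : nat, pfun (n.-tuple nat) nat -> Prop :=
| PR_zero n : @partial_recursive n (fun=> Some 0)
| PR_succ : @partial_recursive 1 (fun v => Some (thead v).+1)
| PR_proj n (i : 'I_n) : @partial_recursive n (fun v => Some (tnth v i))
| PR_comp m n (f : pfun (m.-tuple nat) nat) (g : 'I_m -> pfun (n.-tuple nat) nat)
    (h : pfun (n.-tuple nat) nat) :
    partial_recursive f -> (forall i, partial_recursive (g i)) ->
    (forall v y, h v = Some y <->
       exists w : m.-tuple nat,
         (forall i, g i v = Some (tnth w i)) /\ f w = Some y) ->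
    partial_recursive h
| PR_rec n (f : pfun (n.-tuple nat) nat) (g : pfun (n.+2.-tuple nat) nat) :
    partial_recursive f -> partial_recursive g ->
    @partial_recursive n.+1 (fun v => prim_rec f g [tuple of behead v] (thead v))
| PR_mu n (f : pfun (n.+1.-tuple nat) nat) (h : pfun (n.-tuple nat) nat) :
    partial_recursive f ->
    (forall v y, h v = Some y <->
       f [tuple of y :: v] = Some 0 /\
       (forall z, z < y -> exists k, f [tuple of z :: v] = Some k.+1)) ->
    partial_recursive h.

Definition computable1 (f : pfun nat nat) : Prop :=
  partial_recursive (fun v : 1.-tuple nat => f (tnth v ord0)).

Definition computable2 (f : nat -> pfun nat nat) : Prop :=
  partial_recursive (fun v : 2.-tuple nat => f (tnth v ord0) (tnth v ord_max)).

Definition total_computable (p : nat -> nat) : Prop :=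
  computable1 (fun n => Some (p n)).

(* Acceptable Goedel numberings, by Rogers' characterisation: numberings of the
   unary partial computable functions that satisfy the utm- and smn-theorems. *)
Record acceptable (phi : nat -> pfun nat nat) : Prop := Acceptable {
  numbering_computable : forall i, computable1 (phi i);
  numbering_onto : forall f, computable1 f -> exists i, phi i = f;
  numbering_utm : computable2 phi;
  numbering_smn : forall psi : nat -> pfun nat nat, computable2 psi ->
    exists s : nat -> nat, total_computable s /\
      forall k, phi (s k) = psi k }.

(* N^N with the product topology of the discrete topology on nat. *)
Definition baire : Type := prod_topology (fun _ : nat => nat).

HB.instance Definition _ := Nbhs.on baire.
HB.instance Definition _ := Topological.on baire.

(* The default value used outside the domain is irrelevant, as continuity only
   refers to the subspace topology of the domain. *)
Definition pcontinuous (F : pfun baire baire) : Prop :=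
  {within pdom F, continuous (fun p : baire => odflt (fun=> 0 : nat) (F p) : baire)}.

Definition pairB (p q : baire) : baire :=
  fun n => if odd n then q n./2 else p n./2.

Definition fstB (r : baire) : baire := fun n => r n.*2.

Definition sndB (r : baire) : baire := fun n => r n.*2.+1.

Lemma pairBK1 p q : fstB (pairB p q) = p.
Proof. by apply: funext => n; rewrite /fstB /pairB odd_double doubleK. Qed.

Lemma pairBK2 p q : sndB (pairB p q) = q.
Proof.
by apply: funext => n; rewrite /sndB /pairB /= odd_double uphalf_double.
Qed.

Record rep_space := RepSpace {
  carrier :> Type;
  rep : pfun baire carrier;
  rep_surj : forall x : carrier, exists p, rep p = Some x }.

Arguments rep : clear implicits.

Lemma rep_baire_surj (x : baire) : exists p : baire, Some p = Some x.
Proof. by exists x. Qed.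

Definition baireR : rep_space :=
  @RepSpace baire (fun p => Some p) rep_baire_surj.

Lemma rep_nat_surj (x : nat) : exists p : baire, Some (p 0) = Some x.
Proof. by exists (fun=> x). Qed.

Definition natR : rep_space :=
  @RepSpace nat (fun p => Some (p 0)) rep_nat_surj.

Definition rep_prod (X Y : rep_space) : pfun baire (X * Y) := fun r =>
  obind (fun x => omap (pair x) (rep Y (sndB r))) (rep X (fstB r)).

Lemma rep_prod_surj (X Y : rep_space) (z : X * Y) :
  exists r, @rep_prod X Y r = Some z.
Proof.
case: z => x y; have [p px] := rep_surj x; have [q qy] := rep_surj y.
by exists (pairB p q); rewrite /rep_prod pairBK1 pairBK2 px /= qy.
Qed.

Definition prodR (X Y : rep_space) : rep_space :=
  @RepSpace (X * Y) (@rep_prod X Y) (@rep_prod_surj X Y).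

(* A partial multivalued map from X to Y is a map f : X -> set Y, whose domain
   consists of the points with nonempty image. *)
Definition mdom (X Y : Type) (f : X -> set Y) : set X := [set x | f x !=set0].

Definition realizes (X Y : rep_space) (F : pfun baire baire) (f : X -> set Y) :
    Prop :=
  forall p x, rep X p = Some x -> mdom f x ->
    exists q y, [/\ F p = Some q, rep Y q = Some y & f x y].

Record problem := Problem {
  src : rep_space;
  tgt : rep_space;
  mmap :> src -> set tgt;
  has_realizer : exists F, realizes F mmap }.

(* In the presence of choice, every multivalued map has a realizer. *)
Lemma realizer_exists (X Y : rep_space) (f : X -> set Y) :
  exists F, realizes F f.
Proof.
have /choice [F HF] : forall p : baire, exists o : option baire,
    forall x, rep X p = Some x -> mdom f x ->
      exists q y, [/\ o = Some q, rep Y q = Some y & f x y].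
  move=> p; case px: (rep X p) => [x|]; last by exists None.
  have [[y fxy]|fx0] := pselect (mdom f x); last first.
    by exists None => x' [<-] /fx0.
  by have [q qy] := rep_surj y; exists (Some q) => x' [<-] _; exists q, y.
by exists F => p x; exact: HF.
Qed.

Definition mk_problem (X Y : rep_space) (f : X -> set Y) : problem :=
  Problem (realizer_exists f).

Definition problem_continuous (f : problem) : Prop :=
  exists F, pcontinuous F /\ realizes F f.

(* The partial function <id, F>. *)
Definition pair_id (F : pfun baire baire) : pfun baire baire :=
  fun p => omap (pairB p) (F p).

Definition leW (f g : problem) : Prop :=
  exists H L : pfun baire baire, [/\ pcontinuous H, pcontinuous L &
    forall Gam, realizes Gam g -> realizes (pcomp H (pair_id (pcomp Gam L))) f].

Definition lesW (f g : problem) : Prop :=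
  exists H L : pfun baire baire, [/\ pcontinuous H, pcontinuous L &
    forall Gam, realizes Gam g -> realizes (pcomp H (pcomp Gam L)) f].

Definition eqW (f g : problem) : Prop := leW f g /\ leW g f.

Definition eqsW (f g : problem) : Prop := lesW f g /\ lesW g f.

Definition goedel_map (phi : nat -> pfun nat nat) (p : baire) : set nat :=
  [set i | phi i = (fun n => Some (p n))].

Lemma mdom_goedel_map (phi : nat -> pfun nat nat) : acceptable phi ->
  mdom (goedel_map phi) = [set p : baire | total_computable p].
Proof.
move=> phiA; apply/seteqP; split=> [p [i pi]|p /(numbering_onto phiA) [i pi]].
  by rewrite /= /total_computable -pi; exact: numbering_computable.
by exists i.
Qed.

(* Single-valued: K p is the singleton of the least index of p. *)
Definition kolmogorov_map (phi : nat -> pfun nat nat) (p : baire) : set nat :=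
  [set i | goedel_map phi p i /\ forall j, goedel_map phi p j -> i <= j].

Definition kolmogorov_ge_map (phi : nat -> pfun nat nat) (p : baire) : set nat :=
  [set m | exists k, kolmogorov_map phi p k /\ k <= m].

Definition goedel_ge_map (phi : nat -> pfun nat nat) (z : baire * nat) : set nat :=
  [set i | kolmogorov_ge_map phi z.1 z.2 /\ goedel_map phi z.1 i].

Definition problem_G (phi : nat -> pfun nat nat) : problem :=
  @mk_problem baireR natR (goedel_map phi).

Definition problem_K (phi : nat -> pfun nat nat) : problem :=
  @mk_problem baireR natR (kolmogorov_map phi).

Definition problem_Kge (phi : nat -> pfun nat nat) : problem :=
  @mk_problem baireR natR (kolmogorov_ge_map phi).

Definition problem_Gge (phi : nat -> pfun nat nat) : problem :=
  @mk_problem (prodR baireR natR) natR (goedel_ge_map phi).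

Definition problem_B : problem :=
  @mk_problem baireR natR (fun p : baire => [set m | forall n, p n <= m]).

Definition problem_CN : problem :=
  @mk_problem baireR natR (fun p : baire => [set n | forall k, p k <> n]).

(* Main.v *)
From mathcomp Require Import all_boot.
From mathcomp Require Import boolp classical_sets topology.
Require Import Defs.

Set Implicit Arguments.
Unset Strict Implicit.
Unset Printing Implicit Defensive.

Local Open Scope classical_set_scope.
Local Open Scope nat_scope.

(** The equivalences are topological, so every preprocessing and
    postprocessing map may consult an arbitrary oracle, for instance the values
    and the domains of all the functions phi i; a map on natural numbers is
    continuous whatever it is.

    The strong equivalences all rest on one auxiliary problem, to find the
    maximum of a bounded sequence of natural numbers.

    - Closed choice and K reduce to the maximum: in both cases one looks for
      the least number that passes countably many tests, each of which looks
      at one entry of the input (for closed choice, i passes the test k on p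
      if p k <> i; for K, if phi i k = p k). The least number that passes the
      first n tests grows with n up to the answer
      (closed_choice_maximum, kolmogorov_maximum). An upper bound of the same
      sequence is an upper bound of K (kolmogorov_ge_bound).
    - The maximum reduces to closed choice: guess the maximum together with a
      position where it is attained; a wrong guess is refuted by finitely many
      entries (maximum_closed_choice).
    - The maximum reduces to G, and B to an upper bound of K: copy the input,
      but keep a nonzero value only where it exceeds all earlier
      values. Since a bounded sequence has finitely many such records, the
      result has finite support, hence is computable. Writing the record
      itself, one can read the maximum off any index of the result
      (maximum_goedel). Writing at each record v a value that differs from
      those of the functions phi i with i <= v, one pushes every index of the
      result above the maximum (bound_kolmogorov_ge).

    Finally, if a bound m of K(p) is known, then a prefix of p whose length
    depends on m alone distinguishes the functions among phi 0, ..., phi m;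
    any index up to m that agrees with p on that prefix is an index of p
    (separating_bound, goedel_ge_continuous). Hence an upper bound of
    K(p) is as good as an index, provided that p itself is still available,
    which is why G reduces to K>= by an ordinary reduction here. *)

(** * Continuity on Baire space *)

Definition agree (T : Type) (N : nat) (p q : nat -> T) : Prop :=
  forall k, k < N -> p k = q k.

Lemma nbhs_agree (p : baire) (N : nat) : nbhs p [set q : baire | agree N q p].
Proof.
elim: N => [|N IH]; first by apply: filterS filterT => q _ k.
have cN : nbhs p [set q : baire | q N = p N].
  exact: (@proj_continuous nat (fun=> nat) N p [set p N] (discrete_set1 _)).
apply: filterS (filterI IH cN) => q [qp qN] k.
by rewrite ltnS leq_eqVlt => /orP[/eqP->|/qp].
Qed.

(** The number N of entries used may vary with the input p: to find an index of
    a sequence from a bound m, one reads a prefix whose length depends on m,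
    and m is itself part of the input. *)
Definition finite_use (f : baire -> baire) : Prop :=
  forall p n, exists N, forall q : baire, agree N q p -> f q n = f p n.

Lemma finite_use_continuous (f : baire -> baire) :
  finite_use f -> continuous f.
Proof.
move=> fu p; apply/cvg_sup => n A [_ [[B oB <-] Bfp sBA]].
have [N HN] := fu p n.
apply: filterS (nbhs_agree p N) => q /HN qn; apply: sBA.
by rewrite /preimage /= [X in B X]qn.
Qed.

Lemma pcontinuous_total (f : baire -> baire) :
  continuous f -> pcontinuous (fun p => Some (f p)).
Proof. by move=> cf; apply: continuous_subspaceT. Qed.

(** * Reductions between problems from sequences to numbers *)

(** Strong reducibility with realizers eliminated. A name of a number matters
    only through the number, so the postprocessing is a mere function on
    numbers and is continuous for free. *)
Definition reducible (f g : baire -> set nat) : Prop :=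
  exists (L : baire -> baire) (h : nat -> nat), continuous L /\
    forall p, f p !=set0 ->
      g (L p) !=set0 /\ forall m, g (L p) m -> f p (h m).

Lemma reducible_lesW (f g : baire -> set nat) : reducible f g ->
  lesW (@mk_problem baireR natR f) (@mk_problem baireR natR g).
Proof.
move=> [L [h [cL Lh]]].
exists (fun r => Some (fun=> h (r 0))), (fun p => Some (L p)).
split; [|exact: pcontinuous_total|].
  apply: pcontinuous_total; apply: finite_use_continuous => p n; exists 1.
  by move=> q ->.
move=> Gam rG p _ [<-] /Lh [gL hL].
have [q [y [Gq [<-] /hL fh]]] := rG (L p) (L p) erefl gL.
by exists (fun=> h (q 0)), (h (q 0)); rewrite /pcomp /= Gq.
Qed.

Lemma reducible_trans f g k :
  reducible f g -> reducible g k -> reducible f k.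
Proof.
move=> [L [h [cL Lh]]] [M [j [cM Mj]]].
exists (M \o L), (h \o j); split=> [p|p /Lh [/Mj [kML jML] hL]].
  by apply: continuous_comp; [exact: cL|exact: cM].
by split=> // m /jML /hL.
Qed.

(** * Computability of sequences with finite support *)

Lemma partial_recursive_const n c :
  @partial_recursive n (fun=> Some c).
Proof.
elim: c => [|c IH]; first exact: PR_zero.
apply: (PR_comp PR_succ (fun=> IH)) => v y; split=> [[<-]|[w [cw [<-]]]].
  by exists [tuple c]; split=> // i; rewrite (ord1 i).
by have [->] := cw ord0.
Qed.

(** Prepending an entry is primitive recursion whose step ignores the previous
    value. *)
Lemma total_computable_cons c (p : nat -> nat) :
  total_computable p ->
  total_computable (fun n => if n is n'.+1 then p n' else c).
Proof.
move=> cp.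
have cg : @partial_recursive 2 (fun v => Some (p (tnth v ord0))).
  apply: (PR_comp cp (fun=> PR_proj ord0)) => v y.
  split=> [[<-]|[w [cw [<-]]]].
    by exists [tuple tnth v ord0]; split=> // i; rewrite (ord1 i).
  by have [->] := cw ord0.
have := PR_rec (partial_recursive_const 0 c) cg.
rewrite /total_computable /computable1; congr partial_recursive.
apply/funext => v; rewrite -[thead v]/(tnth v ord0).
by elim: (tnth v ord0) => [//|k IH] /=; rewrite IH.
Qed.

Lemma total_computable_finsupp N (p : nat -> nat) :
  (forall n, N <= n -> p n = 0) -> total_computable p.
Proof.
elim: N p => [|N IH] p p0.
  have -> : p = fun=> 0 by apply/funext => n; exact: p0.
  exact: partial_recursive_const.
have -> : p = fun n => if n is n'.+1 then p n'.+1 else p 0.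
  by apply/funext => -[].
by apply: total_computable_cons; apply: (IH (p \o succn)) => n Nn; exact: p0.
Qed.

(** * The maximum of a bounded sequence *)

Lemma exists_least (P : nat -> Prop) : (exists i, P i) ->
  exists i, P i /\ forall j, P j -> i <= j.
Proof.
move=> [i Pi]; have ex : exists i, `[< P i >] by exists i; apply/asboolP.
case: (ex_minnP ex) => m /asboolP Pm min; exists m; split=> // j Pj.
by apply: min; apply/asboolP.
Qed.

Definition maximum (u : baire) : set nat :=
  [set m | (exists n, u n = m) /\ forall n, u n <= m].

Lemma maximum_inj u m n : maximum u m -> maximum u n -> m = n.
Proof.
move=> [[i <-] le] [[j <-] ge]; apply/eqP; rewrite eqn_leq.
by rewrite ge le.
Qed.

Lemma bounded_maximum (u : baire) b :
  (forall n, u n <= b) -> exists m, maximum u m.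
Proof.
move=> ub.
have ex : exists m, `[< exists n, u n = m >].
  by exists (u 0); apply/asboolP; exists 0.
have le m : `[< exists n, u n = m >] -> m <= b by move=> /asboolP[n <-].
case: (ex_maxnP ex le) => m /asboolP um max; exists m; split=> // n.
by apply: max; apply/asboolP; exists n.
Qed.

(** * The least number that passes all tests *)

(** The test T i k of the candidate i may look at the entry k of the input
    only; thereby finitely many tests use finitely many entries. *)
Definition passes (T : nat -> nat -> nat -> bool) (p : baire) (n i : nat) :=
  all (fun k => T i k (p k)) (iota 0 n).

(** Only candidates below n compete at stage n. When none of them is left,
    find returns n, which again does not exceed any candidate that passes all
    tests. *)
Definition least_passing T (p : baire) : baire :=
  fun n => find (passes T p n) (iota 0 n).

Lemma passesP (T : nat -> nat -> nat -> bool) (p : baire) n i :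
  reflect (forall k, k < n -> T i k (p k)) (passes T p n i).
Proof.
apply: (iffP allP) => [H k kn|H k]; last by rewrite mem_iota => /H.
by apply: H; rewrite mem_iota.
Qed.

Lemma least_passing_continuous T : continuous (least_passing T).
Proof.
apply: finite_use_continuous => p n; exists n => q qp.
apply: eq_find => i; apply: eq_in_all => k.
by rewrite mem_iota => /qp->.
Qed.

(** The candidate i stays an upper bound since it is never discarded. It is
    attained because each of the finitely many smaller candidates fails some
    test: the stage n below comes after all these failures. *)
Lemma least_passing_maximum (T : nat -> nat -> nat -> bool) (p : baire) i :
  (forall k, T i k (p k)) ->
  (forall j, (forall k, T j k (p k)) -> i <= j) ->
  maximum (least_passing T p) i.
Proof.
move=> Ti mini.
have le n : least_passing T p n <= i.
  rewrite leqNgt; apply/negP => lt.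
  have := before_find 0 lt.
  have ni : i < n by rewrite (leq_trans lt)// -{2}(size_iota 0 n) find_size.
  by rewrite nth_iota// add0n => /passesP; apply.
split=> //.
have bad : forall j : 'I_i, exists k, ~~ T j k (p k).
  move=> j; apply/not_existsP => H.
  have /mini : forall k, T j k (p k) by move=> k; apply/negPn/negP/H.
  by rewrite leqNgt ltn_ord.
have {bad}[w bad] := choice bad.
pose n := maxn i.+1 (\max_(j < i) (w j).+1).
exists n; apply/eqP; rewrite eqn_leq le leqNgt; apply/negP => lt.
have sz : size (iota 0 n) = n by exact: size_iota.
have ltn : least_passing T p n < n.
  by rewrite (leq_ltn_trans (le n))// leq_maxl.
have := @nth_find _ 0 (passes T p n) (iota 0 n).
rewrite has_find sz => /(_ ltn); rewrite nth_iota// add0n.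
move=> /passesP /(_ (w (Ordinal lt))).
rewrite (negbTE (bad (Ordinal lt))) => H; suff: false by [].
apply: H; rewrite leq_max; apply/orP; right.
exact: (leq_bigmax_cond (F := fun j : 'I_i => (w j).+1)).
Qed.

(** * Closed choice and the maximum *)

Definition closed_choice (p : baire) : set nat :=
  [set n | forall k, p k <> n].

Lemma closed_choice_maximum : reducible closed_choice maximum.
Proof.
pose T i (k v : nat) := v != i.
exists (least_passing T), id; split; first exact: least_passing_continuous.
move=> p /exists_least [i [pi mini]].
have max : maximum (least_passing T p) i.
  apply: least_passing_maximum => [k|j Tj]; first exact/eqP/pi.
  by apply: mini => k; apply/eqP/Tj.
split; first by exists i.
move=> m [[n <-] H]; suff -> : least_passing T p n = i by [].
case: max => -[n' <-] H'; apply/eqP; rewrite eqn_leq.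
by have := H n'; have := H' n => /= -> ->.
Qed.

(** The code c stands for the guess that the maximum is v and is attained at
    position n. *)
Definition confirms (u : baire) (c k : nat) : bool :=
  if unpickle c is Some (v, n) then (u n == v) && (u k <= v) else false.

(** A wrong code c is announced as c.+1, since an input of closed choice must
    have an entry at each position and 0 then serves as the neutral one. A
    number that encodes no guess counts as wrong, so that closed choice never
    returns it. *)
Definition unconfirmed (u : baire) : baire := fun m =>
  if unpickle m is Some (c, k) then if confirms u c k then 0 else c.+1 else 0.

Lemma unconfirmed_continuous : continuous unconfirmed.
Proof.
apply: finite_use_continuous => u m; rewrite /unconfirmed /confirms.
case: (unpickle m) => [[c k]|]; last by exists 0.
case: (unpickle c) => [[v n]|]; last by exists 0.
exists (maxn n k).+1 => q qu.
by rewrite !qu // ltnS (leq_maxl, leq_maxr).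
Qed.

Lemma maximum_closed_choice : reducible maximum closed_choice.
Proof.
pose guess r := if (unpickle r.-1 : option (nat * nat)) is Some (v, _) then v
                else 0.
exists unconfirmed, guess.
split=> [|u [v0 [[n0 un0] le0]]]; first exact: unconfirmed_continuous.
have good0 k : confirms u (pickle (v0, n0)) k.
  by rewrite /confirms pickleK un0 eqxx le0.
split.
  exists (pickle (v0, n0)).+1 => m; rewrite /unconfirmed.
  case: (unpickle m) => [[c k]|//]; case: ifP => // /negP bad [cE].
  by apply: bad; rewrite cE good0.
case=> [|c] miss.
  (* The neutral entry 0 does occur, as the correct guess is never refuted. *)
  case: (miss (pickle (pickle (v0, n0), 0))).
  by rewrite /unconfirmed pickleK good0.
have good k : confirms u c k.
  apply/negPn/negP => bad; case: (miss (pickle (c, k))).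
  by rewrite /unconfirmed pickleK (negbTE bad).
rewrite /guess /=; move: good; rewrite /confirms.
case: (unpickle c) => [[v n] good|/(_ 0)//].
split=> [|k]; last by case/andP: (good k).
by exists n; case/andP: (good 0) => /eqP.
Qed.

(** * Marking records *)

Definition is_record (u : baire) n := all (fun k => u k < u n) (iota 0 n).

Definition mark_records (F : nat -> nat -> nat) (u : baire) : baire :=
  fun n => if is_record u n then F n (u n) else 0.

Lemma mark_records_continuous F : continuous (mark_records F).
Proof.
apply: finite_use_continuous => u n; exists n.+1 => q qu.
rewrite /mark_records /is_record qu //.
congr (if _ then _ else _); apply: eq_in_all => k.
by rewrite mem_iota => kn; rewrite qu // ltnS ltnW.
Qed.

(** No record occurs after a position where the maximum is attained. *)
Lemma mark_records_computable F u m : maximum u m ->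
  total_computable (mark_records F u).
Proof.
move=> [[n <-] le]; apply: (@total_computable_finsupp n.+1) => k nk.
rewrite /mark_records; case: ifP => // /allP /(_ n).
by rewrite mem_iota => /(_ nk); rewrite ltnNge le.
Qed.

Lemma maximum_record u m : maximum u m ->
  exists n, u n = m /\ is_record u n.
Proof.
move=> [/exists_least [n [un mini]] le]; exists n; split=> //.
apply/allP => k; rewrite mem_iota add0n => /= kn.
rewrite un ltn_neqAle le andbT; apply: contraTN kn => /eqP/mini.
by rewrite -leqNgt.
Qed.

(** * Indices of computable sequences *)

Definition bound (p : baire) : set nat := [set m | forall n, p n <= m].

Section Goedel.
Variables (phi : nat -> pfun nat nat) (phi_acc : acceptable phi).

Definition goedel_test i k v := phi i k == Some v.

Lemma goedel_tests p i :
  goedel_map phi p i <-> forall k, goedel_test i k (p k).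
Proof.
split=> [pi k|Ti]; first by rewrite /goedel_test pi.
by apply/funext => k; apply/eqP/Ti.
Qed.

Lemma kolmogorov_least_passing p i : kolmogorov_map phi p i ->
  maximum (least_passing goedel_test p) i.
Proof.
move=> [/goedel_tests gi mini]; apply: least_passing_maximum => // j.
by move=> /goedel_tests /mini.
Qed.

Lemma goedel_kolmogorov p :
  goedel_map phi p !=set0 -> kolmogorov_map phi p !=set0.
Proof. exact: exists_least. Qed.

Lemma kolmogorov_maximum : reducible (kolmogorov_map phi) maximum.
Proof.
exists (least_passing goedel_test), id.
split=> [|p [i pi]]; first exact: least_passing_continuous.
have max := kolmogorov_least_passing pi.
by split=> [|m /(maximum_inj max) <-//]; exists i.
Qed.

Lemma kolmogorov_ge_bound : reducible (kolmogorov_ge_map phi) bound.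
Proof.
exists (least_passing goedel_test), id.
split=> [|p [_ [i [pi _]]]]; first exact: least_passing_continuous.
have [[n max] le] := kolmogorov_least_passing pi.
split=> [|m ub]; first by exists i.
by exists i; split=> //; rewrite -max; exact: ub.
Qed.

Lemma mark_records_goedel F u m : maximum u m ->
  goedel_map phi (mark_records F u) !=set0.
Proof.
move=> /(mark_records_computable F) /(numbering_onto phi_acc)[i pi].
by exists i.
Qed.

(** The sequence of the records of u has the same maximum as u, and any of its
    indices determines it. *)
Lemma maximum_goedel : reducible maximum (goedel_map phi).
Proof.
pose top i v := exists p, goedel_map phi p i /\ maximum p v.
exists (mark_records (fun=> id)), (fun i => xget 0 (top i)).
split=> [|u [m um]]; first exact: mark_records_continuous.
split=> [|i pi]; first exact: mark_records_goedel um.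
have max : maximum (mark_records (fun=> id) u) m.
  split=> [|n]; last by rewrite /mark_records; case: ifP => // _; apply um.
  have [n [un rn]] := maximum_record um.
  by exists n; rewrite /mark_records rn.
have [q [qi qv]] : top i (xget 0 (top i)).
  by apply: xgetPex; exists m, (mark_records (fun=> id) u).
have qE : mark_records (fun=> id) u = q.
  by apply/funext => n; have := congr1 (@^~ n) pi; rewrite qi => -[].
have mE : m = xget 0 (top i) by apply: (maximum_inj max); rewrite qE.
by rewrite -mE.
Qed.

(** A value at n that none of phi 0, ..., phi v takes there. *)
Definition diagonal n v := (\max_(i < v.+1) odflt 0 (phi i n)).+1.

(** At the position r where u first attains its maximum m, the marked sequence
    differs from phi i for all i <= m, so all its indices are above m. *)
Lemma bound_kolmogorov_ge : reducible bound (kolmogorov_ge_map phi).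
Proof.
exists (mark_records diagonal), id.
split=> [|u [b /bounded_maximum[m um]]]; first exact: mark_records_continuous.
split=> [|k [i [[pi _] ik]] n].
  have /goedel_kolmogorov[i pi] := @mark_records_goedel diagonal u m um.
  by exists i, i.
apply: leq_trans (leq_trans _ ik); first exact: um.2.
have [r [ur rr]] := maximum_record um.
rewrite leqNgt; apply/negP => im.
have := congr1 (@^~ r) pi; rewrite /mark_records rr ur /diagonal => /= E.
suff : (\max_(j < m.+1) odflt 0 (phi j r)).+1 <=
       \max_(j < m.+1) odflt 0 (phi j r) by rewrite ltnn.
have lt : i < m.+1 by exact: ltnW.
have := leq_bigmax (F := fun j : 'I_m.+1 => odflt 0 (phi j r)) (Ordinal lt).
by rewrite /= E.
Qed.

(** Finitely many functions have finitely many pairs, and a pair of distinct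
    functions differs at some argument (possibly one where just one of the two
    is defined). *)
Lemma separating_bound m : exists N, forall i j, i <= m -> j <= m ->
  agree N (phi i) (phi j) -> phi i = phi j.
Proof.
have sep (ij : 'I_m.+1 * 'I_m.+1) : exists k,
    phi ij.1 k = phi ij.2 k -> phi ij.1 = phi ij.2.
  have [->|ne] := pselect (phi ij.1 = phi ij.2); first by exists 0.
  apply/not_existsP => H; apply: ne; apply/funext => k.
  by apply/not_notP => ne; apply: (H k) => /ne.
have [w wP] := choice sep.
exists (\max_ij (w ij).+1) => i j im jm ag.
apply: (wP (Ordinal (im : i < m.+1), Ordinal (jm : j < m.+1))).
by apply: ag; exact: (leq_bigmax (F := fun ij => (w ij).+1)).
Qed.

(** The least index up to m that agrees with p below N m, where N is given by
    separating_bound, is correct: K(p) is another such index, so both denote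
    the same function. *)
Lemma goedel_ge_continuous : problem_continuous (problem_Gge phi).
Proof.
have [N NP] := choice separating_bound.
pose G (r : baire) : baire := fun=>
  find (passes goedel_test (fstB r) (N (sndB r 0))) (iota 0 (sndB r 0).+1).
exists (fun r => Some (G r)); split.
  apply: pcontinuous_total; apply: finite_use_continuous => r ?.
  (* In the name r of (p, m), the number m is r 1 and p k is r k.*2. *)
  exists (maxn 2 (N (sndB r 0)).*2) => q qr.
  have q1 : sndB q 0 = sndB r 0 by apply: qr; rewrite leq_max.
  rewrite /G q1; apply: eq_find => i; apply: eq_in_all => k.
  rewrite mem_iota => /= kN; rewrite /fstB qr //.
  by rewrite leq_max ltn_double kN orbT.
move=> r [p m]; rewrite /= /rep_prod /= => -[<- <-].
move=> [? [[k [kK km]] _]]; have [kp _] := kK; set s := sndB r 0 in km *.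
have kpass : has (passes goedel_test (fstB r) (N s)) (iota 0 s.+1).
  apply/hasP; exists k; first by rewrite mem_iota.
  by apply/passesP => l _; apply: (goedel_tests _ _).1.
have Gs : G r 0 < s.+1 by move: kpass; rewrite has_find size_iota.
exists (G r), (G r 0); split=> //; split=> /=; first by exists k.
rewrite /goedel_map /= -kp; apply: (NP s) => // l lN.
have := nth_find 0 kpass; rewrite nth_iota // add0n => /passesP /(_ l lN) /eqP.
by rewrite -/s kp.
Qed.

Lemma kolmogorov_ge_goedel :
  leW (problem_Kge phi) (problem_G phi).
Proof.
exists (fun r => Some (sndB r)), (fun p => Some p); split.
- apply: pcontinuous_total; apply: finite_use_continuous => r n.
  by exists n.*2.+2 => q; apply; rewrite ltnS.
- by apply: pcontinuous_total => p; exact: cvg_id.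
move=> Gam GamG p _ [<-] [_ [i [[pi mini] _]]].
have [q [_ [Gq [<-] qi]]] := GamG p p erefl (ex_intro _ i pi).
exists q, (q 0); split=> //.
  by rewrite /pcomp /pair_id /= Gq /= pairBK2.
by exists i; split; [split|exact: mini].
Qed.

(** A continuous realizer of the problem of goedel_ge_continuous serves as
    postprocessing: its inputs are the pairs of p and a bound for p. *)
Lemma goedel_kolmogorov_ge : leW (problem_G phi) (problem_Kge phi).
Proof.
have [F [cF rF]] := goedel_ge_continuous.
exists F, (fun p => Some p); split=> //.
  by apply: pcontinuous_total => p; exact: cvg_id.
move=> Gam GamK p _ [<-] pG; have [i pi] := goedel_kolmogorov pG.
have pK : kolmogorov_ge_map phi p i by exists i.
have [q [_ [Gq [<-] qK]]] := GamK p p erefl (ex_intro _ i pK).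
have pq : rep (prodR baireR natR) (pairB p q) = Some (p, q 0).
  by rewrite /= /rep_prod /= pairBK1 pairBK2.
have [j [_ [Fj [<-] [_ pj]]]] := rF _ _ pq (ex_intro _ i (conj qK pi.1)).
by exists j, (j 0); split=> //; rewrite /pcomp /pair_id /= Gq /= Fj.
Qed.

Lemma goedel_reducible_kolmogorov :
  reducible (goedel_map phi) (kolmogorov_map phi).
Proof.
exists id, id; split=> [p|p /goedel_kolmogorov ?]; first exact: cvg_id.
by split=> // i [].
Qed.
End Goedel.

Theorem theorem14 (phi : nat -> pfun nat nat) (phi_acc : acceptable phi) :
  eqsW problem_B (problem_Kge phi) /\
  eqW (problem_Kge phi) (problem_G phi) /\
  eqsW (problem_G phi) (problem_K phi) /\
  eqsW (problem_K phi) problem_CN /\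
  problem_continuous (problem_Gge phi).
Proof.
have K_CN := reducible_trans (kolmogorov_maximum phi) maximum_closed_choice.
have CN_G := reducible_trans closed_choice_maximum (maximum_goedel phi_acc).
have G_K := goedel_reducible_kolmogorov phi.
repeat split; try exact: reducible_lesW.
- exact/reducible_lesW/bound_kolmogorov_ge.
- exact/reducible_lesW/kolmogorov_ge_bound.
- exact: kolmogorov_ge_goedel.
- exact: goedel_kolmogorov_ge.
- exact/reducible_lesW/(reducible_trans K_CN).
- exact/reducible_lesW/(reducible_trans CN_G).
- exact: goedel_ge_continuous.
Qed.
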